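(* For every integer $d>0$ there exists a concept class $\mathcal{C}\subseteq\{0,1\}^n$ (for some $n$) with $\mathtt{vc}(\mathcal{C})=d$ such that every extremal class $\mathcal{C}'\subseteq\{0,1\}^n$ with $\mathcal{C}\subseteq\mathcal{C}'$ satisfies $\mathtt{vc}(\mathcal{C}')\geq 2^d-1$.
   Context: A concept class is a subset $\mathcal{C}\subseteq\{0,1\}^n$; each $c\in\mathcal{C}$ is viewed as a function $c:[n]\to\{0,1\}$. $\mathcal{C}$ shatters $\{x_1,\dots,x_k\}\subseteq[n]$ if $\{(c(x_1),\dots,c(x_k)):c\in\mathcal{C}\}=\{0,1\}^k$ (the empty set is always shattered). $\mathtt{vc}(\mathcal{C})$ is the largest size of a set shattered by $\mathcal{C}$. Let $\mathtt{shatter}(\mathcal{C})$ be the family of all subsets of $[n]$ shattered by $\mathcal{C}$; $\mathcal{C}$ is called extremal if $|\mathcal{C}|=|\mathtt{shatter}(\mathcal{C})|$. *)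

(* Defs.v *)
From mathcomp Require Import all_boot.

Set Implicit Arguments.
Unset Strict Implicit.
Unset Printing Implicit Defensive.

Definition concept (n : nat) := {ffun 'I_n -> bool}.

Definition concept_class (n : nat) := {set concept n}.

Definition restrict (n : nat) (X : {set 'I_n}) (c : concept n) :
    {ffun {x : 'I_n | x \in X} -> bool} :=
  [ffun x => c (val x)].

(* For a nonempty class the image of [restrict set0] is already the full
   one-element set; the disjunct [X == set0] matters only for the empty class,
   where it enforces the convention that the empty set is always shattered. *)
Definition shatters (n : nat) (C : concept_class n) (X : {set 'I_n}) : bool :=
  (X == set0) || ([set restrict X c | c in C] == [set: {ffun {x : 'I_n | x \in X} -> bool}]).

Definition shatter (n : nat) (C : concept_class n) : {set {set 'I_n}} :=
  [set X | shatters C X].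

Definition vc (n : nat) (C : concept_class n) : nat :=
  \max_(X in shatter C) #|X|.

Definition extremal (n : nat) (C : concept_class n) : Prop :=
  #|C| = #|shatter C|.

(* Main.v *)
(** An extremal class shatters a set exactly when it contains a full cube in
    those directions, and this passes to subcubes and to links. Hence, by
    Mayer-Vietoris along a coordinate, the cubical complex of a nonempty extremal
    class [X] is acyclic over F_2, and so is that of its intersection with any
    subcube; its dimension is at most [vc X].

    Let [k] concepts of [X] be dual-shattered. Sending a set [S] of them to the
    smallest subcube containing [S], intersected with [X], gives an acyclic
    carrier, hence a chain map [phi] from the simplex on [k] vertices, and
    disjoint faces have disjoint carriers because some coordinate separates them.
    The topological Radon (van Kampen-Flores) obstruction, here the powers of the
    Stiefel-Whitney class of the deleted join evaluated on the boundary of the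
    cross-polytope, forces [phi S] and [phi (~: S)] to be both nonzero for some
    [S]. As [phi S] has dimension [#|S| - 1], this gives [k <= 2 vc X + 2].

    The class of the [k = 2^(d+1) - 1] membership concepts on all subsets of [k]
    points has VC dimension [d] and is dual-shattered. *)

Require Import Defs.
From mathcomp Require Import all_boot all_algebra.

Set Implicit Arguments.
Unset Strict Implicit.
Unset Printing Implicit Defensive.

Import GRing.Theory.

(** * Shattered sets and full cubes of extremal classes *)

Section Shattering.
Variable n : nat.
Implicit Types (X Y : concept_class n) (S : {set 'I_n}) (x : 'I_n) (b : bool).

(* Differs from [shatters] only in that the empty class realizes nothing. *)
Definition realizes X S : bool :=
  [forall f : concept n, exists c in X, [forall x in S, c x == f x]].

Definition realized X : {set {set 'I_n}} := [set S | realizes X S].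

Lemma realizesP X S :
  reflect (forall f : concept n, exists2 c, c \in X & {in S, c =1 f})
          (realizes X S).
Proof.
apply: (iffP forallP) => H f.
  by have /exists_inP[c cX /forall_inP cf] := H f; exists c => // x /cf/eqP.
have [c cX cf] := H f; apply/exists_inP; exists c => //.
by apply/forall_inP => x xS; rewrite cf.
Qed.

Lemma shattersE X S : X != set0 -> shatters X S = realizes X S.
Proof.
case/set0Pn=> c0 c0X; rewrite /shatters; apply/orP/realizesP.
  case=> [/eqP-> f|/eqP H f]; first by exists c0 => // x; rewrite inE.
  have: restrict S f \in [set restrict S c | c in X] by rewrite H inE.
  case/imsetP=> c cX /ffunP E; exists c => // x xS.
  by have := E (exist _ x xS); rewrite !ffunE.
move=> H; right; apply/eqP/setP=> g; rewrite inE.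
pose f : concept n :=
  [ffun x => if insub x is Some y then g y else false].
have [c cX cf] := H f; apply/imsetP; exists c => //.
apply/ffunP=> y; rewrite ffunE cf ?(valP y) // ffunE.
by rewrite valK.
Qed.

Definition halfspace X x b : concept_class n := [set c in X | c x == b].

Lemma card_halves X x : #|halfspace X x true| + #|halfspace X x false| = #|X|.
Proof.
rewrite -(cardsID [set c : concept n | c x] X); congr (_ + _); apply: eq_card => c.
  by rewrite !inE eqb_id.
by rewrite !inE andbC; case: (c x).
Qed.

Lemma realizes_sub X Y S : X \subset Y -> realizes X S -> realizes Y S.
Proof.
move=> /subsetP XY /realizesP H; apply/realizesP=> f.
by have [c /XY cY cf] := H f; exists c.
Qed.

Lemma half_sub X x b : halfspace X x b \subset X.
Proof. by apply/subsetP=> c; rewrite inE => /andP[]. Qed.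

Lemma realizes_half_notin X S x b : realizes (halfspace X x b) S -> x \notin S.
Proof.
move/realizesP/(_ [ffun=> ~~ b])=> [c]; rewrite inE => /andP[_ /eqP cx] cf.
by apply/negP=> /cf; rewrite ffunE cx; case: b {cx cf}.
Qed.

Lemma realizes_halves X S x :
  realizes (halfspace X x true) S -> realizes (halfspace X x false) S ->
  realizes X (x |: S).
Proof.
move=> H1 H0; apply/realizesP=> f.
have /realizesP/(_ f)[c] : realizes (halfspace X x (f x)) S by case: (f x).
rewrite inE => /andP[cX /eqP cx] cf; exists c => // y.
by rewrite !inE => /predU1P[->|/cf].
Qed.

Lemma realized_halves_sub X x :
  realized (halfspace X x true) :|: realized (halfspace X x false)
    \subset realized X :\: [set S : {set 'I_n} | x \in S].
Proof.
apply/subsetP=> S; rewrite !inE => /orP[] H.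
  by rewrite (realizes_half_notin H) (realizes_sub (half_sub X x true)).
by rewrite (realizes_half_notin H) (realizes_sub (half_sub X x false)).
Qed.

(** Adding [x] is injective on the sets realized by both halves, as none of them contains [x], and
    by [realizes_halves] it yields realized sets of [X]. *)
Lemma card_realizedI X x :
  #|realized (halfspace X x true) :&: realized (halfspace X x false)|
    <= #|realized X :&: [set S : {set 'I_n} | x \in S]|.
Proof.
rewrite -(card_in_imset (f := fun S => x |: S)); last first.
  move=> S T; rewrite !inE => /andP[/realizes_half_notin xS _].
  move=> /andP[/realizes_half_notin xT _] E.
  by rewrite -(setU1K xS) E setU1K.
apply/subset_leq_card/subsetP=> _ /imsetP[S + ->].
by rewrite !inE eqxx andbT => /andP[H1 H0]; apply: realizes_halves.
Qed.

Lemma card_realized_halves X x :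
  #|realized (halfspace X x true)| + #|realized (halfspace X x false)| <= #|realized X|.
Proof.
rewrite -cardsUI -(cardsID [set S : {set 'I_n} | x \in S] (realized X)) addnC.
by rewrite leq_add ?card_realizedI // subset_leq_card ?realized_halves_sub.
Qed.

Lemma class_split X (c c' : concept n) : c \in X -> c' \in X -> c != c' ->
  exists2 x, halfspace X x true != set0 & halfspace X x false != set0.
Proof.
move=> cX c'X /eqP ne; have [x nx] : exists x, c x != c' x.
  apply/existsP; rewrite -negb_forall; apply/forallP=> E; case: ne.
  by apply/ffunP=> x; apply/eqP.
exists x; apply/set0Pn; move: nx; case cx: (c x); case c'x: (c' x) => // _.
- by exists c; rewrite inE cX cx.
- by exists c'; rewrite inE c'X c'x.
- by exists c'; rewrite inE c'X c'x.
- by exists c; rewrite inE cX cx.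
Qed.

Lemma half_proper X x b : halfspace X x (~~ b) != set0 -> #|halfspace X x b| < #|X|.
Proof.
rewrite -card_gt0 -(card_halves X x); case: b => /= H.
  by rewrite -[X in X < _]addn0 ltn_add2l.
by rewrite -[X in X < _]add0n ltn_add2r.
Qed.

(** Two distinct concepts differ at some [x], so both halves in direction [x] are smaller than [X]
    and the inequalities for them add up by [card_realized_halves]. *)
Lemma pajor_inequality X : #|X| <= #|realized X|.
Proof.
have [m] := ubnP #|X|; elim: m X => // m IH X leX.
have [->|[c cX]] := set_0Vmem X; first by rewrite cards0.
have [E|[c']] := set_0Vmem (X :\ c).
  have -> : X = [set c] by apply/eqP; rewrite eqEsubset -setD_eq0 E eqxx sub1set.
  rewrite cards1 card_gt0; apply/set0Pn; exists set0; rewrite inE.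
  by apply/realizesP=> f; exists c => [|x]; rewrite inE.
rewrite !inE => /andP[ne c'X]; have [x n1 n0] := class_split c'X cX ne.
rewrite -(card_halves X x) (leq_trans _ (card_realized_halves X x)) //.
by apply: leq_add; apply: IH; apply: leq_trans (half_proper _) leX.
Qed.

(** Extremality in terms of [realizes]. The empty class is tight although not extremal, so tightness
    passes to halves without a nonemptiness condition. *)
Definition tight X := #|realized X| = #|X|.

Lemma extremal_tight X : X != set0 -> extremal X -> tight X.
Proof.
move=> X0 exX; rewrite /tight exX; apply: eq_card => S; by rewrite !inE shattersE.
Qed.

(** Pajor's inequality for the two halves sums to at most [#|realized X|], which equals [#|X|], so
    neither inequality can be strict. *)
Lemma tight_half X x b : tight X -> tight (halfspace X x b).
Proof.
move=> tX; have := card_realized_halves X x; rewrite tX -(card_halves X x).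
have := pajor_inequality (halfspace X x true).
have := pajor_inequality (halfspace X x false).
rewrite /tight => h0 h1 h; apply/eqP; rewrite eqn_leq pajor_inequality andbT.
case: b; rewrite leqNgt; apply/negP=> lt; move: h; rewrite leqNgt => /negP[].
  by rewrite -addSn leq_add.
by rewrite -addnS leq_add.
Qed.

(** Tightness turns the counts behind [card_realized_halves] into equalities, so the sets realized
    by some half are all the realized sets that avoid [x]. *)
Lemma tight_realizes_half X S x : tight X -> realizes X S -> x \notin S ->
  exists b, realizes (halfspace X x b) S.
Proof.
move=> tX rS xS.
have E : realized (halfspace X x true) :|: realized (halfspace X x false)
    = realized X :\: [set S : {set 'I_n} | x \in S].
  apply/eqP; rewrite eqEcard realized_halves_sub /=.
  have := card_realizedI X x.
  rewrite -(leq_add2l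
    #|realized (halfspace X x true) :|: realized (halfspace X x false)|).
  rewrite cardsUI (tight_half x true tX) (tight_half x false tX) card_halves -tX.
  by rewrite -[X in X <= _](cardsID [set S : {set 'I_n} | x \in S]) addnC leq_add2r.
have /setP/(_ S) := E; rewrite !inE rS xS /= => /orP[]; first by exists true.
by exists false.
Qed.

(** While two concepts disagree off [S], pass to a smaller half that still realizes [S]. Once all
    agree off [S], realizing [S] means containing the whole cube. *)
Lemma tight_cube X S : tight X -> realizes X S ->
  exists2 v, v \in X & forall c : concept n, {in ~: S, c =1 v} -> c \in X.
Proof.
have [m] := ubnP #|X|; elim: m X => // m IH X leX tX rS.
have [v vX _] := realizesP X S rS [ffun=> false].
case: (boolP [forall c in X, forall x in ~: S, c x == v x]) => [/forall_inP agree|].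
  exists v => // c cv; have [c' c'X c'c] := realizesP X S rS c.
  suff -> : c = c' by [].
  apply/ffunP=> x; case: (boolP (x \in S)) => [/c'c//|xS].
  have xS' : x \in ~: S by rewrite inE.
  by have /forall_inP/(_ x xS')/eqP-> := agree _ c'X; rewrite cv.
rewrite negb_forall_in => /exists_inP[c cX]; rewrite negb_forall_in => /exists_inP[x].
rewrite inE => xS cv; have [b rb] := tight_realizes_half tX rS xS.
have lt : #|halfspace X x b| < m.
  rewrite -ltnS; apply: leq_trans leX; rewrite ltnS; apply: half_proper.
  apply/set0Pn; case: (eqVneq (c x) b) => [E|E]; [exists v|exists c];
    rewrite inE ?vX ?cX /=.
    by move: cv; rewrite E; case: b {rb E} => //=; case: (v x).
  by move: E; case: b {rb}; case: (c x).
have [w] := IH _ lt (tight_half x b tX) rb.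
rewrite inE => /andP[wX _] H; exists w => // c1 /H.
by rewrite inE => /andP[].
Qed.

Implicit Types L : seq ('I_n * bool).

Definition subclass X L : concept_class n :=
  [set c in X | all (fun p => c p.1 == p.2) L].

Lemma tight_subclass X L : tight X -> tight (subclass X L).
Proof.
elim: L X => [|[x b] L IH] X tX.
  by have -> : subclass X [::] = X by apply/setP=> c; rewrite inE andbT.
have -> : subclass X ((x, b) :: L) = subclass (halfspace X x b) L.
  by apply/setP=> c; rewrite !inE /= andbA.
exact/IH/tight_half.
Qed.

(** Quantifying over the subcubes [L] builds in heredity, which the induction over halves and links
    needs. *)
Definition cubical X := forall L S, realizes (subclass X L) S ->
  exists2 v, v \in subclass X L &
    forall c : concept n, {in ~: S, c =1 v} -> c \in subclass X L.

Lemma tight_cubical X : tight X -> cubical X.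
Proof. by move=> tX L S; apply/tight_cube/tight_subclass. Qed.

Lemma cubical_subclass X L : cubical X -> cubical (subclass X L).
Proof.
move=> cX L' S; have -> : subclass (subclass X L) L' = subclass X (L ++ L').
  by apply/setP=> c; rewrite !inE all_cat andbA.
exact: cX.
Qed.

Lemma cubical_half X x b : cubical X -> cubical (halfspace X x b).
Proof.
have -> : halfspace X x b = subclass X [:: (x, b)].
  by apply/setP=> c; rewrite !inE /= andbT.
exact: cubical_subclass.
Qed.

Definition upd (T : Type) (f : {ffun 'I_n -> T}) x (t : T) : {ffun 'I_n -> T} :=
  [ffun y => if y == x then t else f y].

(* The common part of the two halves in direction [x], placed in the half
   [c x = false]. *)
Definition link X x : concept_class n :=
  [set c in X | ~~ c x & upd c x true \in X].

(** Nonempty halves mean that [[set x]] is realized, so [X] contains an edge in direction [x]; its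
    lower end lies in the link. *)
Lemma cubical_edge X x : cubical X ->
  halfspace X x true != set0 -> halfspace X x false != set0 -> link X x != set0.
Proof.
move=> cX /set0Pn[c1 h1] /set0Pn[c0 h0].
have [|v] := cX [::] [set x].
  apply/realizesP=> f; exists (if f x then c1 else c0).
    rewrite inE andbT; move: h1 h0; rewrite !inE => /andP[? _] /andP[? _].
    by case: (f x).
  move=> y; rewrite inE => /eqP->; move: h1 h0; rewrite !inE.
  by move=> /andP[_ /eqP c1x] /andP[_ /eqP c0x]; case: (f x).
move=> _ H; have Hb b : upd v x b \in X.
  have /H : {in ~: [set x], upd v x b =1 v}.
    by move=> y; rewrite !inE ffunE => /negbTE->.
  by rewrite inE => /andP[].
apply/set0Pn; exists (upd v x false); rewrite inE Hb ffunE eqxx /=.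
suff -> : upd (upd v x false) x true = upd v x true by [].
by apply/ffunP=> y; rewrite !ffunE; case: eqP.
Qed.

(** If the link realizes [S], then [X] realizes [x |: S], and the lower face of the resulting cube
    lies in the link. *)
Lemma cubical_link X x : cubical X -> cubical (link X x).
Proof.
move=> cX L S rS; have /realizesP rSP := rS.
have [c0] := rSP [ffun=> true]; rewrite !inE => /andP[/and3P[_ c0x _] c0L] _.
have xS : x \notin S.
  apply/negP=> xS; have [c] := rSP [ffun=> true].
  by rewrite !inE => /andP[/and3P[_ cx _] _] /(_ _ xS); rewrite ffunE (negbTE cx).
(* Constraints at [x] would keep [X] from realizing [x |: S]. Dropping them is harmless: [c0] shows
   that they only ask for [false], the value of every link concept at [x]. *)
pose L' := [seq p <- L | p.1 != x].
have updL' (c : concept n) b : all (fun p => c p.1 == p.2) L ->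
    all (fun p => upd c x b p.1 == p.2) L'.
  move=> /allP cL; apply/allP=> p; rewrite mem_filter => /andP[px pL].
  by rewrite ffunE (negbTE px); apply: cL.
have backL (c : concept n) : ~~ c x -> all (fun p => c p.1 == p.2) L' ->
    all (fun p => c p.1 == p.2) L.
  move=> cx /allP cL'; apply/allP=> p pL; case: (eqVneq p.1 x) => px; last first.
    by apply: cL'; rewrite mem_filter px.
  by have := allP c0L p pL; rewrite px (negbTE cx) (negbTE c0x).
have [|v] := cX L' (x |: S).
  apply/realizesP=> f; have [c] := rSP f.
  rewrite !inE => /andP[/and3P[cX' cx c1X] cL] cf.
  exists (upd c x (f x)).
    rewrite inE updL' // andbT; case: (f x) => //.
    suff -> : upd c x false = c by [].
    by apply/ffunP=> y; rewrite ffunE; case: eqP => // ->; rewrite (negbTE cx).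
  move=> y; rewrite !inE ffunE; case: eqP => [->//|_ /=]; exact: cf.
rewrite inE => /andP[vX vL'] H.
have HL (c : concept n) : {in ~: S, c =1 upd v x false} -> c \in subclass (link X x) L.
  move=> cv; have cx : ~~ c x by rewrite cv ?inE // ffunE eqxx.
  have cv' b : upd c x b \in subclass X L'.
    apply: H => y; rewrite !inE negb_or ffunE => /andP[/negbTE yx yS].
    by rewrite yx cv ?inE // ffunE yx.
  have cE : upd c x false = c.
    by apply/ffunP=> y; rewrite ffunE; case: eqP => // ->; rewrite (negbTE cx).
  have := cv' false; have := cv' true; rewrite cE !inE => /andP[c1X _] /andP[cX' cL'].
  by rewrite cX' cx c1X backL.
by exists (upd v x false); first exact: HL.
Qed.
End Shattering.

Local Open Scope ring_scope.

(** * Chains over F_2 *)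

Lemma addFF (a : 'F_2) : a + a = 0.
Proof. by apply: val_inj; case: a => -[|[|]]. Qed.

Lemma addF_eq0 (a b : 'F_2) : a + b = 0 -> a = b.
Proof. by move=> H; rewrite -[a]addr0 -(addFF b) addrA H add0r. Qed.

Lemma F2_cases (a : 'F_2) : a = 0 \/ a = 1.
Proof. by case: a => -[|[|//]] i; [left|right]; apply: val_inj. Qed.

Section Chains.
Variable T : finType.
Definition chain := {ffun T -> 'F_2}.
Implicit Types (z : chain) (f g : T -> chain).

Lemma addcE z z' P : (z + z') P = z P + z' P.
Proof. by rewrite ffunE. Qed.

Lemma addcc z : z + z = 0.
Proof. by apply/ffunP=> P; rewrite !ffunE addFF. Qed.

Lemma addc_eq z z' : z + z' = 0 -> z = z'.
Proof. by move=> H; rewrite -[z]addr0 -(addcc z') addrA H add0r. Qed.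

Definition gen (Q : T) : chain := [ffun P => (P == Q)%:R].

(** The linear extension to chains of a map given on generators. *)
Definition ext f z : chain := [ffun P => \sum_Q z Q * f Q P].

Lemma extD f z z' : ext f (z + z') = ext f z + ext f z'.
Proof.
apply/ffunP=> P; rewrite !ffunE -big_split; apply: eq_bigr => Q _.
by rewrite ffunE mulrDl.
Qed.

Lemma ext0 f : ext f 0 = 0.
Proof. by apply/ffunP=> P; rewrite !ffunE big1 // => Q _; rewrite ffunE mul0r. Qed.

Lemma ext_sum f (I : Type) (r : seq I) (p : pred I) (F : I -> chain) :
  ext f (\sum_(i <- r | p i) F i) = \sum_(i <- r | p i) ext f (F i).
Proof. exact: (big_morph _ (extD f) (ext0 f)). Qed.

Lemma ext_gen f Q : ext f (gen Q) = f Q.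
Proof.
apply/ffunP=> P; rewrite ffunE (bigD1 Q) //= big1 ?addr0 ?ffunE ?eqxx ?mul1r //.
by move=> R /negbTE nR; rewrite ffunE nR mul0r.
Qed.

Lemma ext_add f g z : ext (fun Q => f Q + g Q) z = ext f z + ext g z.
Proof.
apply/ffunP=> P; rewrite !ffunE -big_split; apply: eq_bigr => Q _.
by rewrite ffunE mulrDr.
Qed.

Lemma ext_comp f g z : ext f (ext g z) = ext (fun Q => ext f (g Q)) z.
Proof.
apply/ffunP=> P; rewrite !ffunE.
under eq_bigr => Q _ do rewrite ffunE mulr_suml.
rewrite exchange_big; apply: eq_bigr => R _; rewrite ffunE mulr_sumr.
by apply: eq_bigr => Q _; rewrite mulrA.
Qed.

Lemma ext_id z : ext gen z = z.
Proof.
apply/ffunP=> P; rewrite ffunE (bigD1 P) //= big1 ?addr0 ?ffunE ?eqxx ?mulr1 //.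
by move=> R /negbTE nR; rewrite ffunE eq_sym nR mulr0.
Qed.

Lemma eq_ext f g z : (forall Q, z Q != 0 -> f Q = g Q) -> ext f z = ext g z.
Proof.
move=> E; apply/ffunP=> P; rewrite !ffunE; apply: eq_bigr => Q _.
by case: (eqVneq (z Q) 0) => [->|/E->]; rewrite ?mul0r.
Qed.

Lemma ext_eq0 f z : (forall Q, z Q != 0 -> f Q = 0) -> ext f z = 0.
Proof.
move=> E; apply/ffunP=> P; rewrite !ffunE; apply: big1 => Q _.
by case: (eqVneq (z Q) 0) => [->|/E->]; rewrite ?mul0r // ffunE mulr0.
Qed.

Lemma ext_supp f z P : ext f z P != 0 -> exists2 Q, z Q != 0 & f Q P != 0.
Proof.
rewrite ffunE => nz; apply/exists_inP; apply: contraNT nz.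
rewrite negb_exists_in => /forall_inP H; rewrite big1 // => Q _.
case: (eqVneq (z Q) 0) => [->|/H]; first by rewrite mul0r.
by rewrite negbK => /eqP->; rewrite mulr0.
Qed.

Lemma gen_supp Q P : gen Q P != 0 -> P = Q.
Proof. by rewrite ffunE; case: (eqVneq P Q) => // _ /eqP. Qed.

Lemma addc_supp z z' P : (z + z') P != 0 -> z P != 0 \/ z' P != 0.
Proof.
rewrite ffunE; case: (eqVneq (z P) 0) => [->|_ _]; last by left.
by rewrite add0r => ?; right.
Qed.

Lemma sum_supp (I : finType) (p : pred I) (F : I -> chain) P :
  (\sum_(i | p i) F i) P != 0 -> exists2 i, p i & F i P != 0.
Proof.
rewrite sum_ffunE => nz; apply/exists_inP; apply: contraNT nz.
rewrite negb_exists_in => /forall_inP H; rewrite big1 // => i /H.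
by rewrite negbK => /eqP.
Qed.

(** The terms at [(x, y)] and [(y, x)] cancel over F_2. This is the cancellation behind the
    vanishing of a double boundary, for cubes and for simplices. *)
Lemma sum_offdiag (k : nat) (A : {set 'I_k}) (G : 'I_k -> 'I_k -> chain) :
  (forall x y, G x y = G y x) -> \sum_(x in A) \sum_(y in A :\ x) G x y = 0.
Proof.
move=> GC.
have E x : x \in A -> \sum_(y in A :\ x) G x y
    = \sum_(y in A | (x < y)%N) G x y + \sum_(y in A | (y < x)%N) G x y.
  move=> _; rewrite (bigID (fun y : 'I_k => (x < y)%N)) /=.
  congr (_ + _); apply: eq_bigl => y.
    by rewrite !inE -val_eqE /=; case: ltngtP; rewrite ?andbF ?andbT.
  by rewrite !inE -val_eqE /=; case: ltngtP; rewrite ?andbF ?andbT.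
rewrite (eq_bigr _ E) big_split /= [X in _ + X](_ : _ = \sum_(x in A)
    \sum_(y in A | (x < y)%N) G x y) ?addcc //.
rewrite (exchange_big_dep (mem A)) /=; last by move=> x y _ /andP[].
apply: eq_bigr => x xA; apply: eq_big => [y|y _]; last exact: GC.
by rewrite xA.
Qed.

End Chains.

(** * The Radon obstruction *)

Section Radon.
Variables (T : finType) (bd : T -> chain T) (e : T) (sep : rel T).
Hypotheses (bdK : forall Q, ext bd (bd Q) = 0) (bd_e : bd e = 0).
Hypotheses (sepC : symmetric sep) (sep_irr : forall Q, sep Q Q -> Q = e).
Hypothesis sep_face : forall Q P Q', sep Q Q' -> bd Q P != 0 -> sep P Q'.
Implicit Types (w : T -> T -> 'F_2) (z : chain T).

Definition pairing w z z' : 'F_2 := \sum_Q \sum_Q' z Q * z' Q' * w Q Q'.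

(** The coboundary on cochains of the tensor square. With an augmented complex this models the join
    with itself, and the pairs related by [sep] form the deleted join. *)
Definition cobd w Q Q' := pairing w (bd Q) (gen Q') + pairing w (gen Q) (bd Q').

Lemma pairingDl w z1 z2 z' :
  pairing w (z1 + z2) z' = pairing w z1 z' + pairing w z2 z'.
Proof.
rewrite -big_split; apply: eq_bigr => Q _; rewrite -big_split; apply: eq_bigr => Q' _.
by rewrite ffunE !mulrDl.
Qed.

Lemma pairingC w z z' : pairing w z z' = pairing (fun Q Q' => w Q' Q) z' z.
Proof.
rewrite /pairing exchange_big; apply: eq_bigr => Q _; apply: eq_bigr => Q' _.
by rewrite [z' _ * _]mulrC.
Qed.

Lemma pairing0l w z : pairing w 0 z = 0.
Proof. by apply: big1 => Q _; apply: big1 => Q' _; rewrite ffunE !mul0r. Qed.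

Lemma pairing0r w z : pairing w z 0 = 0.
Proof. by rewrite pairingC pairing0l. Qed.

Lemma pairing_suml w (I : Type) (r : seq I) (p : pred I) (F : I -> chain T) z :
  pairing w (\sum_(i <- r | p i) F i) z = \sum_(i <- r | p i) pairing w (F i) z.
Proof.
exact: (big_morph (fun y => pairing w y z) (fun a b => pairingDl w a b z)
  (pairing0l w z)).
Qed.

Lemma pairing_sumr w (I : Type) (r : seq I) (p : pred I) (F : I -> chain T) z :
  pairing w z (\sum_(i <- r | p i) F i) = \sum_(i <- r | p i) pairing w z (F i).
Proof.
by rewrite pairingC pairing_suml; apply: eq_bigr => i _; rewrite -(pairingC w).
Qed.

Lemma pairing_addw w1 w2 z z' :
  pairing w1 z z' + pairing w2 z z' = pairing (fun Q Q' => w1 Q Q' + w2 Q Q') z z'.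
Proof.
rewrite -big_split; apply: eq_bigr => Q _; rewrite -big_split; apply: eq_bigr => Q' _.
by rewrite mulrDr.
Qed.

Lemma eq_pairing w1 w2 z z' :
  (forall Q Q', z Q != 0 -> z' Q' != 0 -> w1 Q Q' = w2 Q Q') ->
  pairing w1 z z' = pairing w2 z z'.
Proof.
move=> E; apply: eq_bigr => Q _; apply: eq_bigr => Q' _.
case: (eqVneq (z Q) 0) => [->|nz]; first by rewrite !mul0r.
case: (eqVneq (z' Q') 0) => [->|nz']; first by rewrite mulr0 !mul0r.
by rewrite E.
Qed.

Lemma pairing_extl w z z' f :
  pairing w (ext f z) z' = \sum_Q z Q * pairing w (f Q) z'.
Proof.
rewrite /pairing; under eq_bigr => Q _.
  under eq_bigr => Q' _ do rewrite ffunE !mulr_suml.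
  rewrite exchange_big; over.
rewrite exchange_big; apply: eq_bigr => Q _.
rewrite mulr_sumr; apply: eq_bigr => P _; rewrite mulr_sumr.
by apply: eq_bigr => Q' _; rewrite !mulrA.
Qed.

Lemma pairing_cobd w z z' :
  pairing (cobd w) z z' = pairing w (ext bd z) z' + pairing w z (ext bd z').
Proof.
rewrite pairing_extl (pairingC _ _ (ext _ _)) pairing_extl.
transitivity (\sum_Q \sum_Q' (z Q * z' Q' * pairing w (bd Q) (gen Q')
    + z Q * z' Q' * pairing w (gen Q) (bd Q'))).
  by apply: eq_bigr => Q _; apply: eq_bigr => Q' _; rewrite -mulrDr.
under eq_bigr => Q _ do rewrite big_split.
rewrite big_split; congr (_ + _).
  apply: eq_bigr => Q _; rewrite -[z' in RHS]ext_id [pairing _ _ (ext _ _)]pairingC.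
  rewrite pairing_extl mulr_sumr; apply: eq_bigr => Q' _.
  by rewrite -(pairingC w) mulrA.
rewrite exchange_big; apply: eq_bigr => Q' _; rewrite -(pairingC w).
rewrite -[z in RHS]ext_id pairing_extl mulr_sumr; apply: eq_bigr => Q _.
by rewrite mulrA [z' _ * _]mulrC.
Qed.

Lemma cobdK w Q Q' : cobd (cobd w) Q Q' = 0.
Proof.
rewrite {1}/cobd !pairing_cobd !bdK !ext_gen pairing0l pairing0r add0r addr0.
exact: addFF.
Qed.

Lemma cobd_transpose w Q Q' : cobd w Q' Q = cobd (fun P P' => w P' P) Q Q'.
Proof. by rewrite /cobd addrC pairingC; congr (_ + _); rewrite pairingC. Qed.

Lemma cobd_add w1 w2 Q Q' :
  cobd w1 Q Q' + cobd w2 Q Q' = cobd (fun P P' => w1 P P' + w2 P P') Q Q'.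
Proof. by rewrite /cobd addrACA !pairing_addw. Qed.

Lemma eq_cobd w1 w2 Q Q' : (forall P P', sep P P' -> w1 P P' = w2 P P') ->
  sep Q Q' -> cobd w1 Q Q' = cobd w2 Q Q'.
Proof.
move=> E s; congr (_ + _); apply: eq_pairing => P P'.
  by move=> nz /gen_supp->; apply/E/(sep_face s nz).
by move=> /gen_supp-> nz; apply/E; rewrite sepC (sep_face _ nz) // sepC.
Qed.

Lemma cobd_ee w : cobd w e e = 0.
Proof. by rewrite /cobd bd_e pairing0l pairing0r addr0. Qed.

(* Cochain representatives of the powers of the Stiefel-Whitney class of the
   free involution (Q, Q') |-> (Q', Q): each is the coboundary of the previous
   one, cut down to the fundamental domain Q < Q'. *)
Fixpoint swc (i : nat) (Q Q' : T) : 'F_2 :=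
  if i is j.+1 then
    if (enum_rank Q < enum_rank Q')%N then cobd (swc j) Q Q' else 0
  else ((Q == e) && (Q' == e))%:R.

(** Off the diagonal exactly one of the two orders lies in the fundamental domain. The only
    separated diagonal pair is [(e, e)], where coboundaries vanish since [bd e = 0]. *)
Lemma swc_sym i :
  (forall Q Q', sep Q Q' -> cobd (swc i) Q Q' = cobd (swc i) Q' Q) ->
  forall Q Q', sep Q Q' -> swc i.+1 Q Q' + swc i.+1 Q' Q = cobd (swc i) Q Q'.
Proof.
move=> H Q Q' s /=; case: ltngtP => [_|_|/val_inj/enum_rank_inj E].
- by rewrite addr0.
- by rewrite add0r H // sepC.
- by move: s; rewrite -E => /sep_irr->; rewrite cobd_ee addr0.
Qed.

(** Inductively, [swc i.+1] plus its transpose is a coboundary by [swc_sym], so applying [cobd] once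
    more gives 0. *)
Lemma cobd_swcC i Q Q' : sep Q Q' -> cobd (swc i) Q Q' = cobd (swc i) Q' Q.
Proof.
elim: i Q Q' => [|i IH] Q Q' s.
  rewrite [RHS]cobd_transpose; apply: eq_cobd s => P P' _ /=.
  by rewrite andbC.
have /eqP := cobdK (swc i) Q Q'.
rewrite -(eq_cobd (w1 := fun P P' => swc i.+1 P P' + swc i.+1 P' P) _ s).
  rewrite -cobd_add => /eqP H; rewrite [RHS]cobd_transpose.
  exact: addF_eq0 H.
exact: swc_sym.
Qed.

Variables (I : finType) (phi : {set I} -> chain T).
Hypothesis phi0 : phi set0 = gen e.
Hypothesis bd_phi : forall S, ext bd (phi S) = \sum_(i in S) phi (S :\ i).
Hypothesis phi_sep : forall (S S' : {set I}) Q Q', [disjoint S & S'] ->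
  phi S Q != 0 -> phi S' Q' != 0 -> sep Q Q'.

Lemma sum_split_subset (A : {set I}) i (F : {set I} -> 'F_2) : i \in A ->
  \sum_(S : {set I} | S \subset A) F S
    = \sum_(S : {set I} | S \subset A :\ i) (F (i |: S) + F S).
Proof.
move=> iA; rewrite (bigID (fun S : {set I} => i \in S)) big_split /=; congr (_ + _).
  rewrite (reindex_onto (fun S => i |: S) (fun S => S :\ i)) /=; last first.
    by move=> S /andP[_ iS]; rewrite setD1K.
  apply: eq_bigl => S; rewrite setU11 andbT subsetD1 subUset sub1set iA /=.
  congr (_ && _); apply/eqP/idP=> [<-|nS]; last by rewrite setU1K.
  by rewrite !inE eqxx.
by apply: eq_bigl => S; rewrite subsetD1.
Qed.

(** The ordered splittings of [A] are the facets of the boundary of a cross-polytope, on which the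
    top power of the class evaluates to 1. Induction removes one point [i]: the splittings with [i]
    on the left and on the right combine, by [swc_sym], into a coboundary of the previous power. *)
Lemma sum_swc (A : {set I}) :
  \sum_(S : {set I} | S \subset A) pairing (swc #|A|) (phi S) (phi (A :\: S)) = 1.
Proof.
have [m] := ubnP #|A|; elim: m A => // m IH A leA.
have [->|[i iA]] := set_0Vmem A.
  rewrite cards0 (big_pred1 set0) => [|S]; last by rewrite subset0.
  rewrite setD0 phi0 /pairing (bigD1 e) //= (bigD1 e) //= !big1 ?addr0.
  - by rewrite !ffunE !eqxx /= !mulr1.
  - by move=> Q nQ; apply: big1 => Q' _; rewrite (negbTE nQ) mulr0.
  - by move=> Q nQ; rewrite (negbTE nQ) andbF mulr0.
set B := A :\ i; have cA : #|A| = #|B|.+1 by rewrite (cardsD1 i) iA.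
have iB : i \notin B by rewrite !inE eqxx.
have AB : A = i |: B by rewrite setD1K.
rewrite (sum_split_subset _ iA) -/B big_split /=.
(* Complementing [S] in [B] makes these terms the transposes of those with [i] on the left. *)
have -> : \sum_(S : {set I} | S \subset B) pairing (swc #|A|) (phi S) (phi (A :\: S))
   = \sum_(S : {set I} | S \subset B) pairing (swc #|A|) (phi (B :\: S)) (phi (i |: S)).
  rewrite (reindex_onto (fun S => B :\: S) (fun S => B :\: S)) /=; last first.
    by move=> S SB; rewrite setDDr setDv set0U; apply/setIidPr.
  apply: eq_big => S.
    rewrite subsetDl /= setDDr setDv set0U.
    by apply/eqP/idP=> [<-|/setIidPr//]; apply: subsetIl.
  rewrite subsetDl /= setDDr setDv set0U => /eqP SB; congr (pairing _ _ (phi _)).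
  rewrite AB setDUl (setDDr B) setDv set0U SB; congr (_ :|: _).
  apply/setDidPl; rewrite disjoint_sym disjoints_subset; apply/subsetP=> j.
  by rewrite !inE => /andP[_ /andP[]].
rewrite -big_split /=.
(* Moving the coboundary onto the chains, the face of [phi (i |: S)] without [i] gives the sum for
   [B]; the other faces lose some [j] in [B]. *)
transitivity (\sum_(S : {set I} | S \subset B) (pairing (swc #|B|) (phi S) (phi (B :\: S))
   + (\sum_(j in S) pairing (swc #|B|) (phi (i |: S :\ j)) (phi (B :\: S))
     + \sum_(j in B :\: S) pairing (swc #|B|) (phi (i |: S)) (phi ((B :\: S) :\ j))))).
  apply: eq_bigr => S SB; have iS : i \notin S by apply: contra iB; apply: (subsetP SB).
  have -> : A :\: (i |: S) = B :\: S by rewrite AB -setDDl setU1K.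
  rewrite (pairingC _ (phi (B :\: S))) pairing_addw cA.
  have dj : [disjoint i |: S & B :\: S].
    rewrite disjoints_subset; apply/subsetP=> j; rewrite !inE.
    by case: eqP => [->|_ /= ->]; rewrite ?eqxx ?andbF.
  rewrite (eq_pairing (w2 := cobd (swc #|B|))); last first.
    by move=> Q Q' nQ nQ'; apply: swc_sym (phi_sep dj nQ nQ'); apply: cobd_swcC.
  rewrite pairing_cobd !bd_phi big_setU1 //= setU1K // pairingDl -addrA.
  congr (_ + _); rewrite pairing_suml pairing_sumr; congr (_ + _).
  apply: eq_bigr => j jS; congr (pairing _ (phi _) _).
  apply/setP=> l; rewrite !inE; case: (eqVneq l i) => [->|_] //=.
  by rewrite andbT; apply/eqP=> E; rewrite E jS in iS.
rewrite big_split /= IH; last by rewrite -ltnS -cA.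
(* A splitting of [B] with [j] left out arises twice, once with [j] deleted from the left and once
   from the right, so these terms cancel. *)
rewrite big_split /= [X in _ + (_ + X)](_ : _ = \sum_(S : {set I} | S \subset B)
   \sum_(j in S) pairing (swc #|B|) (phi (i |: S :\ j)) (phi (B :\: S))).
  by rewrite addFF addr0.
rewrite (exchange_big_dep (mem B)) /=; last by move=> S j _; rewrite inE => /andP[].
rewrite [RHS](exchange_big_dep (mem B)) /=; last by move=> S j SB; apply: (subsetP SB).
apply: eq_bigr => j jB.
rewrite [RHS](reindex_onto (fun S => j |: S) (fun S => S :\ j)) /=; last first.
  by move=> S /andP[_ jS]; rewrite setD1K.
apply: eq_big => S.
  have {}jB : j \in B := jB.
  rewrite setU11 in_setD subUset sub1set jB !andbT /= andbC [RHS]andbC; congr (_ && _).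
  apply/idP/eqP=> [nS|<-]; first by rewrite setU1K.
  by rewrite !inE eqxx.
move=> /andP[_]; rewrite inE => /andP[jS _]; rewrite setU1K //.
congr (pairing _ _ (phi _)); apply/setP=> l; rewrite !inE.
by case: (l == j).
Qed.

(** Otherwise every term of [sum_swc] for the full set would vanish, while the total is 1. *)
Lemma radon : exists2 S, phi S != 0 & phi (~: S) != 0.
Proof.
apply/exists_inP; apply: contraT; rewrite negb_exists_in => /forall_inP H.
have := sum_swc setT; rewrite big1 => [/eqP|S _]; first by rewrite eq_sym oner_eq0.
rewrite setTD; case: (eqVneq (phi S) 0) => [->|/H]; first by rewrite pairing0l.
by rewrite negbK => /eqP->; rewrite pairing0r.
Qed.

End Radon.

(** * The augmented cubical complex *)

Section Cubes.
Variable n : nat.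
Implicit Types (X Y : concept_class n) (x y : 'I_n).

Lemma updd (T : Type) (f : {ffun 'I_n -> T}) x t t' :
  upd (upd f x t) x t' = upd f x t'.
Proof. by apply/ffunP=> y; rewrite !ffunE; case: eqP. Qed.

Lemma updC (T : Type) (f : {ffun 'I_n -> T}) x y t t' : x != y ->
  upd (upd f x t) y t' = upd (upd f y t') x t.
Proof.
move=> ne; apply/ffunP=> u; rewrite !ffunE; case: (eqVneq u y) => // ->.
by rewrite eq_sym (negbTE ne).
Qed.

Lemma upd_id (T : Type) (f : {ffun 'I_n -> T}) x : upd f x (f x) = f.
Proof. by apply/ffunP=> y; rewrite ffunE; case: eqP => [->|]. Qed.

Lemma updx (T : Type) (f : {ffun 'I_n -> T}) x t : upd f x t x = t.
Proof. by rewrite ffunE eqxx. Qed.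

Lemma updn (T : Type) (f : {ffun 'I_n -> T}) x y t : y != x -> upd f x t y = f y.
Proof. by rewrite ffunE => /negbTE->. Qed.

(* A subcube of {0,1}^n, with [None] marking the free coordinates. *)
Definition cube := {ffun 'I_n -> option bool}.

(* [None] is the cell of dimension -1 that augments the complex. *)
Definition cell := option cube.

Implicit Types (q p : cube) (P Q : cell) (z : chain cell) (c : concept n).

Definition freeset q : {set 'I_n} := [set x | q x == None].

Definition bd Q : chain cell :=
  if Q is Some q then
    (if freeset q == set0 then gen None else 0) +
    \sum_(x in freeset q) \sum_b gen (Some (upd q x (Some b)))
  else 0.

(* The dimension plus one, as [None] has dimension -1. *)
Definition deg Q : nat := if Q is Some q then #|freeset q|.+1 else 0.

Lemma free_upd q x b : freeset (upd q x (Some b)) = freeset q :\ x.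
Proof. by apply/setP=> y; rewrite !inE ffunE; case: (eqVneq y x). Qed.

Lemma bd_supp q P : bd (Some q) P != 0 ->
  (P = None /\ freeset q = set0) \/
  exists x b, q x = None /\ P = Some (upd q x (Some b)).
Proof.
case/addc_supp.
  case: (eqVneq (freeset q) set0) => [fq /gen_supp|_]; first by left.
  by rewrite ffunE eqxx.
case/sum_supp=> x; rewrite inE => /eqP qx /sum_supp[b _ /gen_supp->].
by right; exists x, b.
Qed.

Lemma bd_deg Q P : bd Q P != 0 -> deg Q = (deg P).+1.
Proof.
case: Q => [q|]; last by rewrite ffunE eqxx.
case/bd_supp=> [[-> /= ->]|[x [b [qx ->]]]]; first by rewrite cards0.
by rewrite /= free_upd (cardsD1 x (freeset q)) inE qx.
Qed.

Lemma bdK Q : ext bd (bd Q) = 0.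
Proof.
case: Q => [q|]; last by rewrite ext0.
rewrite [bd (Some q)]/bd extD.
have -> : ext bd (if freeset q == set0 then gen None else 0) = 0.
  by case: ifP; rewrite ?ext_gen ?ext0.
rewrite add0r ext_sum.
transitivity (\sum_(x in freeset q) \sum_(y in freeset q :\ x) \sum_b \sum_b'
    gen (Some (upd (upd q x (Some b)) y (Some b')))).
  apply: eq_bigr => x xf; rewrite ext_sum.
  under eq_bigr => b _ do rewrite ext_gen /= free_upd.
  (* Opposite facets have the same free set, so their augmentation terms cancel. *)
  by rewrite big_split /= big_bool /= addcc add0r exchange_big.
(* Updates commute only at distinct coordinates; the default 0 at [x == y] makes the summand
   symmetric everywhere, as [sum_offdiag] requires. *)
transitivity (\sum_(x in freeset q) \sum_(y in freeset q :\ x) \sum_b \sum_b'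
    if x == y then 0 else gen (Some (upd (upd q x (Some b)) y (Some b')))).
  apply: eq_bigr => x _; apply: eq_bigr => y; rewrite !inE eq_sym.
  by move=> /andP[/negbTE-> _].
apply: sum_offdiag => x y; rewrite exchange_big.
apply: eq_bigr => b _; apply: eq_bigr => b' _; rewrite eq_sym.
by case: eqVneq => // ne; rewrite updC 1?eq_sym.
Qed.

(** * Sweeping and collapsing along one coordinate *)

Section Homotopy.
Variable x : 'I_n.

Definition side b Q : bool := if Q is Some q then q x == Some b else true.

Definition prism Q : chain cell :=
  if Q is Some q then if q x == Some false then gen (Some (upd q x None)) else 0
  else 0.

Definition flip Q : cell :=
  if Q is Some q then Some (upd q x (Some true)) else None.

(** The facets of the swept cell in direction [x] are the cell and its flip; the remaining ones
    cancel against the prisms over the facets of the cell. *)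
Lemma homotopy Q : side false Q ->
  ext bd (prism Q) + ext prism (bd Q) = gen Q + gen (flip Q).
Proof.
case: Q => [q|_]; last by rewrite !ext0 addr0 addcc.
move=> /= qx; rewrite qx ext_gen /= extD.
have fE : freeset (upd q x None) = x |: freeset q.
  by apply/setP=> y; rewrite !inE ffunE; case: (eqVneq y x).
have xf : x \notin freeset q by rewrite inE (eqP qx).
have -> : ext prism (if freeset q == set0 then gen None else 0) = 0.
  by case: ifP; rewrite ?ext_gen ?ext0.
rewrite fE -subset0 subUset sub1set inE /= add0r big_setU1 //= add0r -addrA.
have qE : upd q x (Some false) = q by rewrite -(eqP qx) upd_id.
rewrite big_bool /= !updd qE ext_sum [X in _ + X](_ : _ = 0).
  by rewrite addr0 addrC.
rewrite -big_split big1 //= => y yf; rewrite ext_sum -big_split big1 //= => b _.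
have ne : x != y by apply: contraNneq xf => ->.
rewrite ext_gen /= updn // qx updC //; exact: addcc.
Qed.

(** The connecting map of Mayer-Vietoris: it keeps the cells that cross direction [x] and reads them
    in the link. *)
Definition collapse Q : chain cell :=
  if Q is Some q then if q x == None then gen (Some (upd q x (Some false))) else 0
  else 0.

Definition cut b Q : chain cell :=
  if Q is Some q then if q x == Some b then gen Q else 0 else 0.

(* [cut false] commutes with [bd] up to [collapse] and a multiple of [gen None],
   which [bd] kills. *)
Lemma bd_collapse Q : ext bd (collapse Q) = ext bd (ext (cut false) (bd Q)).
Proof.
case: Q => [q|] /=; last by rewrite !ext0.
rewrite extD ext_sum.
have -> : ext (cut false) (if freeset q == set0 then gen None else 0) = 0.
  by case: ifP; rewrite ?ext_gen ?ext0.
rewrite add0r; under eq_bigr => y _.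
  rewrite ext_sum; under eq_bigr => b _ do rewrite ext_gen /=; over.
case qx: (q x) => [[]|] /=.
- rewrite big1 // => y yf; apply: big1 => b _.
  by rewrite updn ?qx //; apply: contraTneq yf => <-; rewrite inE qx.
- rewrite ext0 (eq_bigr (fun y => \sum_b gen (Some (upd q y (Some b))))).
    have := bdK (Some q); rewrite /= extD => /addc_eq <-.
    by case: ifP => _; rewrite ?ext_gen ?ext0.
  move=> y yf; apply: eq_bigr => b _.
  by rewrite updn ?qx //; apply: contraTneq yf => <-; rewrite inE qx.
- rewrite (bigD1 x) /=; last by rewrite inE qx.
  rewrite big_bool /= !updx /= add0r big1 ?addr0 // => y /andP[_ ne].
  by apply: big1 => b _; rewrite updn ?qx // eq_sym.
Qed.

Lemma bd_collapse_cycle z : ext bd z = 0 -> ext bd (ext collapse z) = 0.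
Proof.
move=> cz; rewrite ext_comp (eq_ext (fun Q _ => bd_collapse Q)).
by rewrite -(ext_comp bd (fun Q => ext (cut false) (bd Q))) -ext_comp cz !ext0.
Qed.

Lemma prism_collapse q z : q x = None ->
  ext prism (ext collapse z) (Some q) = z (Some q).
Proof.
move=> qx; rewrite ext_comp ffunE (bigD1 (Some q)) //= qx /= ext_gen /= updx /=.
rewrite updd -qx upd_id ffunE eqxx mulr1 big1 ?addr0 // => -[p|] nQ; last first.
  by rewrite /= ext0 ffunE mulr0.
rewrite /=; case: eqP => [px|_]; last by rewrite ext0 ffunE mulr0.
rewrite ext_gen /= updx eqxx updd -px upd_id ffunE eq_sym (negbTE nQ); exact: mulr0.
Qed.

End Homotopy.

Definition vertex q (c : concept n) : bool :=
  [forall x, (q x == None) || (q x == Some (c x))].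

Definition complex X : {set cell} :=
  [set Q | if Q is Some q then [forall c, vertex q c ==> (c \in X)] else true].

Lemma complexP X q :
  reflect (forall c, vertex q c -> c \in X) (Some q \in complex X).
Proof.
rewrite inE; apply: (iffP forallP) => H c; first exact/implyP.
exact/implyP/H.
Qed.

Lemma complex_None X : None \in complex X.
Proof. by rewrite inE. Qed.

Lemma vertexP q c : reflect (forall x, q x = None \/ q x = Some (c x)) (vertex q c).
Proof.
apply: (iffP forallP) => H x; first by case/orP: (H x) => /eqP; [left|right].
by case: (H x) => ->; rewrite eqxx ?orbT.
Qed.

Lemma vertex_upd q x b c : q x = None -> vertex (upd q x (Some b)) c -> vertex q c.
Proof.
move=> qx /vertexP H; apply/vertexP=> y; have := H y; rewrite ffunE.
by case: eqP => [-> _|//]; left.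
Qed.

Lemma vertex_ex q : exists c, vertex q c.
Proof.
exists [ffun x => odflt false (q x)]; apply/vertexP=> x; rewrite ffunE.
by case: (q x) => [b|]; [right|left].
Qed.

Lemma vertex_ex_at q x b : q x != Some (~~ b) -> exists2 c, vertex q c & c x = b.
Proof.
move=> qx; have [c /vertexP cq] := vertex_ex q; exists (upd c x b); last exact: updx.
apply/vertexP=> y; rewrite ffunE; case: eqP => [->|_]; last exact: cq.
move: qx; case: (q x) => [b'|]; last by left.
by move=> ne; right; congr Some; apply/eqP; move: ne; case: b; case: b'.
Qed.

Lemma complex_side X x b q : {in X, forall c : concept n, c x = b} ->
  Some q \in complex X -> q x = Some b.
Proof.
move=> Xb /complexP qX; apply/eqP; apply: contraT => ne.
have [|c /qX/Xb cx cx'] := @vertex_ex_at q x (~~ b); first by rewrite negbK.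
by case: b {Xb ne} cx cx' => ->.
Qed.

Lemma complex_bd X Q P : Q \in complex X -> bd Q P != 0 -> P \in complex X.
Proof.
case: Q => [q|_]; last by rewrite ffunE eqxx.
move=> /complexP qX /bd_supp[[-> _]|[x [b [qx ->]]]]; first exact: complex_None.
by apply/complexP=> c /(vertex_upd qx)/qX.
Qed.

Definition carried X z := forall Q, z Q != 0 -> Q \in complex X.

Lemma carriedD X z z' : carried X z -> carried X z' -> carried X (z + z').
Proof. by move=> H H' Q /addc_supp[/H|/H']. Qed.

Lemma carried0 X : carried X 0.
Proof. by move=> Q; rewrite ffunE eqxx. Qed.

Lemma carried_gen X Q : Q \in complex X -> carried X (gen Q).
Proof. by move=> QX P /gen_supp->. Qed.

Lemma carried_sub X Y z : X \subset Y -> carried X z -> carried Y z.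
Proof.
move=> /subsetP XY H [q|] /H; last by rewrite !complex_None.
by move/complexP=> qX; apply/complexP=> c /qX/XY.
Qed.

Lemma carried_ext X Y (f : cell -> chain cell) z : carried X z ->
  (forall Q, Q \in complex X -> carried Y (f Q)) -> carried Y (ext f z).
Proof. by move=> zX H P /ext_supp[Q /zX/H]; apply. Qed.

Lemma carried_bd X z : carried X z -> carried X (ext bd z).
Proof. by move=> zX; apply: (carried_ext zX) => Q QX P; apply: complex_bd. Qed.

End Cubes.
Arguments bd {n} Q.

(** * Acyclicity of nonempty cubical classes *)

Section Acyclic.
Variable n : nat.
Implicit Types (X Y : concept_class n) (x y : 'I_n).
Implicit Types (q p : cube n) (P Q : cell n) (z : chain (cell n)) (c : concept n).

Definition point c : cube n := [ffun x => Some (c x)].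

Lemma free_point c : freeset (point c) = set0.
Proof. by apply/setP=> x; rewrite !inE ffunE. Qed.

Lemma bd_point c : bd (Some (point c)) = gen None.
Proof. by rewrite /= free_point eqxx big_set0 addr0. Qed.

Lemma vertex_point c c' : vertex (point c) c' -> c' = c.
Proof.
by move=> /vertexP H; apply/ffunP=> x; case: (H x); rewrite ffunE // => -[].
Qed.

Lemma complex_point X c : c \in X -> Some (point c) \in complex X.
Proof. by move=> cX; apply/complexP=> c' /vertex_point->. Qed.

Lemma complex1 c q : Some q \in complex [set c] -> q = point c.
Proof.
move=> qX; apply/ffunP=> x; rewrite ffunE; apply: complex_side qX.
by move=> c'; rewrite inE => /eqP->.
Qed.

Lemma link_half X x : link X x \subset halfspace X x false.
Proof.
by apply/subsetP=> c; rewrite !inE => /and3P[-> /negbTE-> _].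
Qed.

Lemma complex_half_side X x b Q : Q \in complex (halfspace X x b) -> side x b Q.
Proof.
case: Q => // q qX; apply/eqP; apply: complex_side qX => c.
by rewrite inE => /andP[_ /eqP].
Qed.

Lemma complex_half X x b Q : Q \in complex X -> side x b Q ->
  Q \in complex (halfspace X x b).
Proof.
case: Q => [q|_ _]; last exact: complex_None.
move=> /complexP qX /= /eqP qx; apply/complexP=> c cq; rewrite inE qX //=.
by have /vertexP/(_ x) := cq; rewrite qx => -[//|[->]].
Qed.

Lemma carried_prism X x z : carried (link X x) z -> carried X (ext (prism x) z).
Proof.
move=> zX; apply: (carried_ext zX) => -[q|_]; last exact: carried0.
move=> /= /complexP qX; case: eqP => [qx|_]; last exact: carried0.
apply/carried_gen/complexP=> c cq; case cx: (c x).
  have /qX : vertex q (upd c x false).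
    apply/vertexP=> y; have /vertexP/(_ y) := cq; rewrite !ffunE.
    by case: (eqVneq y x) => // -> _; right.
  by rewrite inE updd -cx upd_id => /and3P[].
have /qX : vertex q c.
  apply/vertexP=> y; have /vertexP/(_ y) := cq; rewrite !ffunE.
  by case: (eqVneq y x) => // -> _; right; rewrite cx.
by rewrite inE => /and3P[].
Qed.

Lemma carried_collapse X x z : carried X z -> carried (link X x) (ext (collapse x) z).
Proof.
move=> zX; apply: (carried_ext zX) => -[q|_]; last exact: carried0.
move=> /= /complexP qX; case: eqP => [qx|_]; last exact: carried0.
apply/carried_gen/complexP=> c cq.
have cx : c x = false by have /vertexP/(_ x) := cq; rewrite updx => -[//|[->]].
rewrite inE cx qX /=; last exact: vertex_upd cq.
apply: qX; apply/vertexP=> y; have /vertexP/(_ y) := cq; rewrite !ffunE.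
by case: (eqVneq y x) => // -> _; left.
Qed.

Lemma bd_prism x z : (forall Q, z Q != 0 -> side x false Q) ->
  ext bd (ext (prism x) z) + ext (prism x) (ext bd z)
    = z + ext (fun Q => gen (flip x Q)) z.
Proof.
move=> sz; rewrite !ext_comp -ext_add -[X in _ = X + _]ext_id -ext_add.
by apply: eq_ext => Q /sz/homotopy.
Qed.

Lemma cutE x b z Q : ext (cut x b) z Q =
  if Q is Some q then if q x == Some b then z Q else 0 else 0.
Proof.
transitivity (\sum_(P | P == Q)
    (if P is Some q then if q x == Some b then z P else 0 else 0)).
  rewrite ffunE [RHS]big_mkcond; apply: eq_bigr => -[q|] _ /=; last first.
    by rewrite ffunE mulr0; case: ifP.
  case: ifP => _; rewrite ffunE ?mulr0; last by case: ifP.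
  by rewrite [_ == Some q]eq_sym; case: ifP; rewrite ?mulr1 ?mulr0.
by rewrite big_pred1_eq.
Qed.

(** Vanishing of reduced homology in all degrees at once. It fails for the empty class, where the
    cycle [gen None] bounds nothing. *)
Definition acyclic X := forall z, carried X z -> ext bd z = 0 ->
  exists2 y, carried X y & ext bd y = z.

Lemma acyclic1 c : acyclic [set c].
Proof.
move=> z zX cz;
have z2 : ext bd z None = z (Some (point c)).
  rewrite ffunE (bigD1 (Some (point c))) //= -/(bd (Some (point c))) bd_point.
  rewrite ffunE eqxx mulr1 big1 ?addr0 // => -[q|] nq; last by rewrite ffunE mulr0.
  case: (eqVneq (z (Some q)) 0) => [->|/zX/complex1 E]; first by rewrite mul0r.
  by rewrite E eqxx in nq.
have zpt : z (Some (point c)) = 0 by rewrite -z2 cz ffunE.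
have zq q : z (Some q) = 0.
  apply/eqP; apply: contraT => nz; have /complex1 E := zX _ nz.
  by rewrite E zpt eqxx in nz.
have [z0|z1] := F2_cases (z None).
  exists 0; first exact: carried0.
  by rewrite ext0; apply/ffunP=> -[q|]; rewrite ffunE ?z0 ?zq.
exists (gen (Some (point c))).
  by apply/carried_gen/complex_point; rewrite inE.
by rewrite ext_gen bd_point; apply/ffunP=> -[q|]; rewrite ffunE ?z1 ?zq.
Qed.

Lemma bd_side x b z : (forall Q, z Q != 0 -> side x b Q) ->
  forall P, ext bd z P != 0 -> side x b P.
Proof.
move=> sz P /ext_supp[[q|] /sz]; last by rewrite ffunE eqxx.
move=> /= /eqP qx /bd_supp[[-> //]|[y [b' [qy ->]]]] /=.
by rewrite updn ?qx //; apply/eqP=> E; rewrite E qy in qx.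
Qed.

(* Mayer-Vietoris for the cover of the complex by its two halves, glued along
   the prism over the link. *)
Lemma acyclic_split X x :
  acyclic (halfspace X x true) -> acyclic (halfspace X x false) ->
  acyclic (link X x) -> link X x != set0 -> acyclic X.
Proof.
move=> ac1 ac0 acl /set0Pn[v vl] z zX cz.
have [y yl yE] := acl _ (carried_collapse (x := x) zX) (bd_collapse_cycle x cz).
have ys Q : y Q != 0 -> side x false Q.
  by move=> /(carried_sub (link_half X x) yl)/complex_half_side.
(* On cells crossing [x], the added boundary equals the prism over [ext (collapse x) z], which is
   [z] itself there; hence [z'] has no such cells. *)
pose z' := z + ext bd (ext (prism x) y).
have z'X : carried X z' by apply: carriedD => //; apply/carried_bd/carried_prism.
have cz' : ext bd z' = 0.
  rewrite extD cz add0r ext_comp; apply: ext_eq0 => Q _; exact: bdK.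
have z'E q : q x = None -> z' (Some q) = 0.
  move=> qx; have := bd_prism ys; rewrite yE => E.
  have {E} /ffunP/(_ (Some q)) : ext bd (ext (prism x) y)
      = y + ext (fun Q => gen (flip x Q)) y + ext (prism x) (ext (collapse x) z).
    by rewrite -E -addrA addcc addr0.
  rewrite [z' _]addcE => ->; rewrite !addcE prism_collapse //.
  have -> : y (Some q) = 0.
    by apply/eqP; apply: contraT => /ys /=; rewrite qx.
  have -> : ext (fun Q => gen (flip x Q)) y (Some q) = 0.
    apply/eqP; apply: contraT => /ext_supp[[p|] _ /gen_supp] //= [qE].
    by move: qx; rewrite qE updx.
  by rewrite !add0r addFF.
(* The parts of [z'] in the two halves; [cut] drops [None], which therefore stays in [z0]. *)
pose z1 := ext (cut x true) z'; pose z0 := z' + z1.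
have z1s Q : z1 Q != 0 -> side x true Q.
  by rewrite cutE; case: Q => [q|] //=; case: ifP => // _; rewrite eqxx.
have z0s Q : z0 Q != 0 -> side x false Q.
  rewrite ffunE cutE; case: Q => [q|] //=; case qx: (q x) => [[]|] //=.
    by rewrite addFF eqxx.
  by rewrite z'E // addr0 eqxx.
have z1X : carried X z1.
  apply: (carried_ext z'X) => -[q|] QX /=; last exact: carried0.
  by case: ifP => _; [apply: carried_gen|apply: carried0].
have z0X : carried X z0 by apply: carriedD.
have bdz : ext bd z0 = ext bd z1.
  by rewrite extD cz' add0r.
(* The common boundary of [z0] and [z1] lies on both sides of [x], hence is a multiple of
   [gen None]. *)
have bdzE q : ext bd z1 (Some q) = 0.
  apply/eqP; apply: contraT => nz; have /= /eqP qx1 := bd_side z1s nz.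
  by move: nz; rewrite -bdz => /(bd_side z0s) /=; rewrite qx1.
pose v1 := upd v x true.
have [vX vx v1X] : [/\ v \in X, v x = false & v1 \in X].
  by move: vl; rewrite inE => /and3P[-> /negbTE-> ->].
have h0 : v \in halfspace X x false by rewrite inE vX vx.
have h1 : v1 \in halfspace X x true by rewrite inE v1X updx.
(* If that boundary is [gen None], the ends [v] and [v1] of an edge turn both parts into cycles, and
   the edge bounds the two corrections together. Otherwise nothing needs correcting. *)
have [t [t0 t1 tE]] : exists t : chain (cell n) * chain (cell n) * chain (cell n),
   [/\ carried (halfspace X x false) t.1.1 /\ ext bd t.1.1 = ext bd z0,
       carried (halfspace X x true) t.1.2 /\ ext bd t.1.2 = ext bd z1
     & carried X t.2 /\ ext bd t.2 = t.1.1 + t.1.2].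
  have [a0|a1] := F2_cases (ext bd z1 None).
    exists (0, 0, 0) => /=; rewrite ext0 addr0.
    have E : 0 = ext bd z1 by apply/ffunP=> -[q|]; rewrite [LHS]ffunE ?a0 ?bdzE.
    rewrite bdz -E; split; split=> //; exact: carried0.
  have E : gen None = ext bd z1.
    by apply/ffunP=> -[q|]; rewrite [LHS]ffunE ?a1 ?bdzE.
  exists (gen (Some (point v)), gen (Some (point v1)),
    ext (prism x) (gen (Some (point v)))).
  rewrite /= !ext_gen -/(bd (Some (point v))) -/(bd (Some (point v1))) !bd_point bdz.
  split; split=> //; try exact/carried_gen/complex_point.
    rewrite -[prism x _]ext_gen.
    exact/carried_prism/carried_gen/complex_point/vl.
  have := @homotopy _ x (Some (point v)); rewrite bd_point ext_gen addr0 => -> /=.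
    congr (_ + gen (Some _)); apply/ffunP=> u; rewrite !ffunE.
    by case: ifP.
  by rewrite ffunE vx.
case: t0 => t0X t0b; case: t1 => t1X t1b; case: tE => tX tb.
have [||y0 y0X y0E] := ac0 (z0 + t.1.1).
- apply: carriedD => // Q nz; apply: complex_half; [exact: z0X|exact: z0s].
- by rewrite extD t0b addcc.
have [||y1 y1X y1E] := ac1 (z1 + t.1.2).
- apply: carriedD => // Q nz; apply: complex_half; [exact: z1X|exact: z1s].
- by rewrite extD t1b addcc.
exists (y0 + y1 + t.2 + ext (prism x) y).
  apply: carriedD; last exact: carried_prism.
  apply: carriedD => //; apply: carriedD.
    exact: carried_sub (half_sub _ _ _) y0X.
  exact: carried_sub (half_sub _ _ _) y1X.
rewrite !extD y0E y1E tb /z0 /z'.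
set A := ext bd _; set u := t.1.1; set u' := t.1.2.
by rewrite [LHS](AC (4*2*2*1) (1*(2*9)*(3*5)*(4*7)*(6*8))) /= !addcc !addr0.
Qed.

(** Induction on the size: a coordinate that separates two concepts makes both halves smaller than
    [X], and the link embeds in the half [false]. *)
Lemma cubical_acyclic X : cubical X -> X != set0 -> acyclic X.
Proof.
have [m] := ubnP #|X|; elim: m X => // m IH X leX cX /set0Pn[c cX'].
have [E|[c']] := set_0Vmem (X :\ c).
  have -> : X = [set c] by apply/eqP; rewrite eqEsubset -setD_eq0 E eqxx sub1set.
  exact: acyclic1.
rewrite !inE => /andP[ne c'X]; have [x n1 n0] := class_split c'X cX' ne.
have nl := cubical_edge cX n1 n0.
have lt0 : (#|halfspace X x false| < m)%N by apply: leq_trans (half_proper _) leX.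
have lt1 : (#|halfspace X x true| < m)%N by apply: leq_trans (half_proper _) leX.
have ltl := leq_ltn_trans (subset_leq_card (link_half X x)) lt0.
apply: (acyclic_split (x := x) _ _ _ nl).
- exact: IH lt1 (cubical_half cX) n1.
- exact: IH lt0 (cubical_half cX) n0.
- exact: IH ltl (cubical_link cX) nl.
Qed.

End Acyclic.

(** * Dual shattering in extremal classes *)

(** The boundary lowers [deg] by exactly one, so the part of a filling in degree [r.+1] already
    fills [z]. *)
Lemma acyclic_deg n (X : concept_class n) r (z : chain (cell n)) :
  acyclic X -> carried X z -> (forall Q, z Q != 0 -> deg Q = r) -> ext bd z = 0 ->
  exists y, [/\ carried X y, forall Q, y Q != 0 -> deg Q = r.+1 & ext bd y = z].
Proof.
move=> ac zX zr cz; have [y yX yE] := ac z zX cz.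
pose f (Q : cell n) := if deg Q == r.+1 then gen Q else 0.
exists (ext f y); split.
- apply: (carried_ext yX) => Q QX; rewrite /f.
  by case: ifP => _; [apply: carried_gen|apply: carried0].
- move=> P /ext_supp[Q _]; rewrite /f.
  case: (eqVneq (deg Q) r.+1) => [dQ /gen_supp->//|_].
  by rewrite ffunE eqxx.
have fE Q : ext bd (f Q) = if deg Q == r.+1 then bd Q else 0.
  by rewrite /f; case: ifP => _; rewrite ?ext_gen ?ext0.
rewrite ext_comp; apply/ffunP=> P; case: (eqVneq (deg P) r) => dP.
  rewrite -yE !ffunE; apply: eq_bigr => Q _; rewrite fE.
  case: (eqVneq (bd Q P) 0) => [b0|/bd_deg->]; last by rewrite dP eqxx.
  by rewrite b0; case: ifP; rewrite ?b0 // ffunE.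
have -> : z P = 0 by apply/eqP; apply: contraT => /zr E; rewrite E eqxx in dP.
apply/eqP; apply: contraT => /ext_supp[Q _]; rewrite fE.
case: (eqVneq (deg Q) r.+1) => [dQ|_].
  by move/bd_deg; rewrite dQ => -[E]; rewrite E eqxx in dP.
by rewrite ffunE eqxx.
Qed.

Section CellSeparation.
Variable n : nat.
Implicit Types (P Q : cell n).

(** Disjointness of subcubes; [None], as the empty cell, is disjoint from every cell, itself
    included. *)
Definition separated Q Q' : bool :=
  match Q, Q' with
  | Some q, Some q' =>
      [exists x, exists b, (q x == Some b) && (q' x == Some (~~ b))]
  | _, _ => true
  end.

Lemma separatedC : symmetric separated.
Proof.
move=> [q|] [q'|] //=; apply/existsP/existsP=> -[x /existsP[b /andP[E E']]];
  by exists x; apply/existsP; exists (~~ b); rewrite negbK E'.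
Qed.

Lemma separated_irr Q : separated Q Q -> Q = None.
Proof.
case: Q => //= q /existsP[x /existsP[b /andP[/eqP-> /eqP[]]]].
by case: b.
Qed.

Lemma separated_face Q P Q' : separated Q Q' -> bd Q P != 0 -> separated P Q'.
Proof.
case: Q => [q|]; last by move=> _; rewrite ffunE eqxx.
move=> s /bd_supp[[-> _]//|[y [b' [qy ->]]]]; case: Q' s => //= q'.
case/existsP=> x /existsP[b /andP[/eqP qx q'x]].
apply/existsP; exists x; apply/existsP; exists b; rewrite q'x andbT updn ?qx //.
by apply/eqP=> E; rewrite E qy in qx.
Qed.

End CellSeparation.

Lemma vc_ge n (Y : concept_class n) (S : {set 'I_n}) :
  Y != set0 -> realizes Y S -> (#|S| <= vc Y)%N.
Proof.
move=> Y0 rS; apply: (leq_bigmax_cond (F := fun S : {set 'I_n} => #|S|)).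
by rewrite inE shattersE.
Qed.

(** A cube inside [X] realizes the set of its free directions. *)
Lemma deg_vc n (X : concept_class n) (Q : cell n) :
  X != set0 -> Q \in complex X -> (deg Q <= (vc X).+1)%N.
Proof.
case: Q => // q X0 /complexP qX; rewrite ltnS; apply: vc_ge => //.
apply/realizesP=> f.
exists [ffun x => if q x is Some b then b else f x].
  apply: qX; apply/vertexP=> x; rewrite ffunE.
  by case: (q x) => [b|]; [right|left].
by move=> x; rewrite inE ffunE => /eqP->.
Qed.

Section DualShattering.
Variables (n k : nat) (X : concept_class n) (c : 'I_k -> concept n).
Hypotheses (cubX : cubical X) (cX : forall i, c i \in X).
Hypothesis dual_shattered :
  forall S : {set 'I_k}, exists x, forall i, c i x = (i \in S).
Implicit Types S : {set 'I_k}.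

(** For empty [S] all constraints are imposed, contradictory ones included, so [hull set0] is empty
    and carries only multiples of [gen None], the value prescribed for [phi set0]. *)
Definition common S : seq ('I_n * bool) :=
  [seq p <- enum {: 'I_n * bool} | [forall i in S, c i p.1 == p.2]].

Definition hull S := subclass X (common S).

Lemma mem_common S x b : ((x, b) \in common S) = [forall i in S, c i x == b].
Proof. by rewrite mem_filter mem_enum andbT. Qed.

Lemma hull_sub S S' : S \subset S' -> hull S \subset hull S'.
Proof.
move=> /subsetP SS'; apply/subsetP=> a; rewrite !inE => /andP[-> /allP H] /=.
apply/allP=> -[x b]; rewrite mem_common => /forall_inP xb; apply: H.
by rewrite mem_common; apply/forall_inP=> i /SS'/xb.
Qed.

Lemma hull_neq0 S i : i \in S -> hull S != set0.
Proof.
move=> iS; apply/set0Pn; exists (c i); rewrite inE cX; apply/allP=> -[x b].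
by rewrite mem_common => /forall_inP/(_ _ iS).
Qed.

Lemma hull_at S x b : (forall i, i \in S -> c i x = b) ->
  {in hull S, forall a : concept n, a x = b}.
Proof.
move=> H a; rewrite inE => /andP[_ /allP/(_ (x, b)) /=].
by rewrite mem_common => /(_ _)/eqP; apply; apply/forall_inP=> i /H->.
Qed.

Lemma hull_separated S S' Q Q' : [disjoint S & S'] ->
  Q \in complex (hull S) -> Q' \in complex (hull S') -> separated Q Q'.
Proof.
case: Q Q' => [q|] [q'|] // dj qS q'S; have [x xS] := dual_shattered S.
apply/existsP; exists x; apply/existsP; exists true.
rewrite (complex_side (b := true) _ qS) ?(complex_side (b := false) _ q'S) //.
  by apply: hull_at => i iS'; rewrite xS (disjointFl dj iS').
by apply: hull_at => i iS; rewrite xS.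
Qed.

Definition filling (phi : {set 'I_k} -> chain (cell n)) S :=
  [/\ carried (hull S) (phi S), forall Q, phi S Q != 0 -> deg Q = #|S|
    & ext bd (phi S) = \sum_(i in S) phi (S :\ i)].

(** The acyclic carrier argument, by induction on the size of [S]: the chains already chosen on the
    facets of [S] sum to a cycle in [hull S], which bounds there. *)
Lemma fillings m : exists2 phi, phi set0 = gen None &
  forall S, (#|S| <= m)%N -> filling phi S.
Proof.
elim: m => [|m [phi phi0 phiS]].
  exists (fun=> gen None) => // S; rewrite leqn0 cards_eq0 => /eqP->; split.
  - exact/carried_gen/complex_None.
  - by move=> Q /gen_supp->; rewrite cards0.
  - by rewrite ext_gen big_set0.
have ex S : exists y, ((#|S| <= m)%N -> y = phi S) /\ (#|S| = m.+1 ->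
    [/\ carried (hull S) y, forall Q, y Q != 0 -> deg Q = #|S|
      & ext bd y = \sum_(i in S) phi (S :\ i)]).
  case: (eqVneq #|S| m.+1) => cS; last first.
    by exists (phi S); split=> // E; rewrite E eqxx in cS.
  have cD i : i \in S -> #|S :\ i| = m.
    by move=> iS; move: cS; rewrite (cardsD1 i) iS => -[].
  have fD i : i \in S -> filling phi (S :\ i) by move=> /cD E; apply: phiS; rewrite E.
  have [i iS] : exists i, i \in S by apply/set0Pn; rewrite -card_gt0 cS.
  have acS := cubical_acyclic (cubical_subclass (L := common S) cubX) (hull_neq0 iS).
  have [|||y [yS yd yE]] := acyclic_deg (r := m) (z := \sum_(i in S) phi (S :\ i)) acS.
  - move=> Q /sum_supp[j jS]; have [jX _ _] := fD j jS.
    by apply: carried_sub jX _; apply/hull_sub/subsetDl.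
  - by move=> Q /sum_supp[j jS]; have [_ jd _] := fD j jS; move=> /jd->; apply: cD.
  - rewrite ext_sum; under eq_bigr => j jS do have [_ _ ->] := fD j jS.
    by apply: sum_offdiag => a b; rewrite !setDDl setUC.
  by exists y; split=> [|_]; [rewrite cS ltnn|rewrite cS].
have [phi' H] := fin_all_exists ex.
have E S : (#|S| <= m)%N -> phi' S = phi S by have [] := H S.
exists phi' => [|S]; first by rewrite E ?cards0.
have ED i : (#|S| <= m.+1)%N -> i \in S -> phi' (S :\ i) = phi (S :\ i).
  by move=> le iS; apply: E; move: le; rewrite (cardsD1 i) iS.
move=> le; rewrite /filling (eq_bigr _ (fun i => ED i le)).
move: le; rewrite leq_eqVlt => /predU1P[cS|lt]; first by have [_ /(_ cS)] := H S.
by rewrite E //; apply: phiS.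
Qed.

Lemma dual_shattered_cubes :
  exists S Q Q',
    [/\ Q \in complex X, Q' \in complex X, deg Q = #|S| & deg Q' = #|~: S|].
Proof.
have [phi phi0 phiS] := fillings #|'I_k|.
have {}phiS S : filling phi S by apply/phiS/max_card.
have phi_sep S S' Q Q' : [disjoint S & S'] ->
    phi S Q != 0 -> phi S' Q' != 0 -> separated Q Q'.
  have [cS _ _] := phiS S; have [cS' _ _] := phiS S'.
  by move=> dj /cS QS /cS' Q'S; apply: hull_separated dj QS Q'S.
have bd_phi S : ext bd (phi S) = \sum_(i in S) phi (S :\ i) by have [] := phiS S.
have bdN : @bd n None = 0 by [].
have [S nS nS'] := radon (@bdK n) bdN (@separatedC n) (@separated_irr n)
  (@separated_face n) phi0 bd_phi phi_sep.
have supp A : phi A != 0 -> exists2 Q, Q \in complex X & deg Q = #|A|.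
  move=> nA; have [cA dA _] := phiS A.
  have [Q nQ] : exists Q, phi A Q != 0.
    apply/existsP; apply: contraNT nA; rewrite negb_exists => /forallP H.
    by apply/eqP/ffunP=> Q; rewrite ffunE; apply/eqP; have := H Q; rewrite negbK.
  exists Q; last exact: dA.
  apply: carried_sub cA _ nQ; apply/subsetP=> a; by rewrite inE => /andP[].
have [Q QX dQ] := supp _ nS; have [Q' Q'X dQ'] := supp _ nS'.
by exists S, Q, Q'.
Qed.

Lemma dual_shattered_vc : X != set0 -> (k <= (vc X).+1 + (vc X).+1)%N.
Proof.
move=> X0; have [S [Q [Q' [QX Q'X dQ dQ']]]] := dual_shattered_cubes.
rewrite -[k]card_ord -(cardsC S) -dQ -dQ'; apply: leq_add; exact: deg_vc.
Qed.

End DualShattering.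

(** * The class of membership concepts *)

Section Example.
Variable k : nat.

Definition member_concept (i : 'I_k) : concept #|{set 'I_k}| :=
  [ffun x => i \in (enum_val x : {set 'I_k})].

Definition member_class : concept_class #|{set 'I_k}| :=
  [set member_concept i | i in 'I_k].

Lemma member_dual_shattered (S : {set 'I_k}) :
  exists x, forall i, member_concept i x = (i \in S).
Proof. by exists (enum_rank S) => i; rewrite ffunE enum_rankK. Qed.

Lemma member_class_neq0 : (0 < k)%N -> member_class != set0.
Proof.
by move=> k0; apply/set0Pn; exists (member_concept (Ordinal k0)); apply: imset_f.
Qed.

(** Shattering [S] takes [2 ^ #|S|] concepts, and the class has at most [k]. *)
Lemma vc_member_le d : (0 < k)%N -> (k < 2 ^ d.+1)%N -> (vc member_class <= d)%N.
Proof.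
move=> k0 kd; apply/bigmax_leqP=> S; rewrite inE => /orP[/eqP->|/eqP H].
  by rewrite cards0.
rewrite -ltnS -(ltn_exp2l _ _ (leqnn 2)); apply: leq_ltn_trans kd.
have <- : #|[set: {ffun {x | x \in S} -> bool}]| = (2 ^ #|S|)%N.
  by rewrite cardsT card_ffun card_bool card_sig; congr (_ ^ _)%N; apply: eq_card.
rewrite -H (leq_trans (leq_imset_card _ _)) // (leq_trans (leq_imset_card _ _)) //.
by rewrite card_ord.
Qed.

Lemma vc_member_ge d : (2 ^ d <= k)%N -> (d <= vc member_class)%N.
Proof.
move=> dk; have k0 : (0 < k)%N by apply: leq_trans dk; rewrite expn_gt0.
have cE : #|{ffun 'I_d -> bool}| = (2 ^ d)%N by rewrite card_ffun card_bool card_ord.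
have le : (#|{ffun 'I_d -> bool}| <= k)%N by rewrite cE.
(* Label [2 ^ d] of the concepts by bit vectors; the point [pt j] is the set of labels whose bit [j]
   is true, so the labelled concepts realize all patterns on the [d] points. *)
pose g (f : {ffun 'I_d -> bool}) : 'I_k := widen_ord le (enum_rank f).
have g_inj : injective g by move=> f f' /(congr1 val) /= /val_inj /enum_rank_inj.
pose pt (j : 'I_d) := enum_rank [set g f | f : {ffun 'I_d -> bool} & f j].
have mem_pt f j : member_concept (g f) (pt j) = f j.
  rewrite ffunE enum_rankK; apply/imsetP/idP=> [[f' + /g_inj->]|fj].
    by rewrite inE.
  by exists f; rewrite ?inE.
have pt_inj : injective pt.
  move=> j j' E; have := mem_pt [ffun u => u == j] j'.
  by rewrite -E mem_pt !ffunE eqxx => /esym/eqP.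
rewrite -[d in X in (X <= _)%N]card_ord -(card_imset _ pt_inj).
apply: vc_ge (member_class_neq0 k0) _; apply/realizesP=> f.
exists (member_concept (g [ffun j => f (pt j)])); first exact: imset_f.
by move=> _ /imsetP[j _ ->]; rewrite mem_pt ffunE.
Qed.

End Example.

Local Close Scope ring_scope.

Theorem theoremA (d : nat) (hd : 0 < d) :
  exists (n : nat) (C : concept_class n),
    vc C = d /\
    (forall C' : concept_class n,
        extremal C' -> C \subset C' -> 2 ^ d - 1 <= vc C').
Proof.
(* The largest [k] allowed by [vc_member_le]. *)
pose k := (2 ^ d.+1).-1; have kE : k.+1 = (2 ^ d.+1) by rewrite prednK ?expn_gt0.
have kd : (2 ^ d <= k).
  by rewrite -ltnS kE ltn_exp2l.
have k0 : (0 < k) by apply: leq_trans kd; rewrite expn_gt0.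
exists _, (member_class k); split.
  by apply/eqP; rewrite eqn_leq vc_member_le ?vc_member_ge // -kE.
move=> C' exC' sub; have C'0 : C' != set0.
  by apply: contraNneq (member_class_neq0 k0) => E; rewrite -subset0 -E.
have := dual_shattered_vc (tight_cubical (extremal_tight C'0 exC'))
  (fun i => subsetP sub _ (imset_f _ (isT : i \in 'I_k)))
  (@member_dual_shattered k) C'0.
(* The bound on [k] becomes [2 ^ d + 2 ^ d <= 2 * vc C' + 3], whereas failure of the goal would give
   [vc C' + 2 <= 2 ^ d]; parity decides. *)
rewrite -ltnS kE expnS mul2n -addnn => H.
rewrite leq_subLR add1n leqNgt; apply/negP=> lt.
by have := leq_trans (leq_add lt lt) H; rewrite addSn addnS ltnn.
Qed.
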